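(* Let $(y_n)_{n\ge 0}$ be defined by $y_0 = 1$ and $y_n = y_{n-1}^2 + 1$ for $n \geq 1$. For every $n \geq 1$ and every $N = y_n^m$ with $m\geq 1$ an integer, $f(N,x)$ can be computed from $x$ using only $2^n \log_{y_n}(N) - 2$ multiplications. Moreover, writing $2^n\log_{y_n}(N) - 2 = \frac{2^n}{\log_2(y_n)}\log_2(N) - 2$, the coefficients satisfy $$\lim_{n\to\infty} \frac{2^n}{\log_2(y_n)} = \log_k(2) = 1.70158\ldots,\qquad \text{where } k = \exp\left(\sum_{n=0}^{\infty} 2^{-n-1}\ln\left(1+y_n^{-2}\right)\right).$$
   Context: For a positive integer $N$, the geometric series on $x$ with $N$ terms is $f(N,x) = \sum_{n=0}^{N-1} x^n$, regarded as a polynomial in the variable $x$. Complexity model: a computation of $f(N,x)$ from $x$ is a finite sequence of steps (a straight-line program) starting from the constant $1$ and the variable $x$, in which each step is an addition, a subtraction or a multiplication of two previously available quantities, and in which $f(N,x)$ is obtained as one of the quantities. Only multiplications (including squarings) are counted; additions and subtractions are free. *)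

(* Defs.v *)
From HB Require Import structures.
From mathcomp Require Import all_boot all_order all_algebra.
From mathcomp Require Import all_classical all_reals all_analysis.

Set Implicit Arguments.
Unset Strict Implicit.
Unset Printing Implicit Defensive.

Import Order.TTheory GRing.Theory Num.Theory.
Import numFieldNormedType.Exports.

Local Open Scope ring_scope.

Fixpoint y (n : nat) : nat := if n is n'.+1 then (y n' ^ 2 + 1)%N else 1%N.

(* Integer coefficients are the strongest choice: a straight-line program over
   {poly int} computes the geometric series over every commutative ring. *)
Definition geom (N : nat) : {poly int} := \sum_(0 <= i < N) 'X^i.

Inductive slp_op : Type := SlpAdd | SlpSub | SlpMul.

Definition slp_apply (o : slp_op) (p q : {poly int}) : {poly int} :=
  match o with
  | SlpAdd => p + q
  | SlpSub => p - q
  | SlpMul => p * q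
  end.

(* In (o, i, j), i and j are the positions of the operands in the list of
   quantities already available; they may coincide (squaring). *)
Definition slp_step : Type := (slp_op * nat * nat)%type.

(* The k-th quantity must be obtained from quantities of index < k. *)
Fixpoint slp_wf (k : nat) (s : seq slp_step) : bool :=
  if s is (_, i, j) :: s' then [&& (i < k)%N, (j < k)%N & slp_wf k.+1 s']
  else true.

Definition slp_exec (vals : seq {poly int}) (st : slp_step) : seq {poly int} :=
  let: (o, i, j) := st in rcons vals (slp_apply o vals`_i vals`_j).

Definition slp_values (s : seq slp_step) : seq {poly int} :=
  foldl slp_exec [:: 1; 'X] s.

Definition slp_is_mul (st : slp_step) : bool :=
  if st.1.1 is SlpMul then true else false.

Definition slp_mults (s : seq slp_step) : nat := count slp_is_mul s.

Definition computes (s : seq slp_step) (p : {poly int}) : Prop :=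
  slp_wf 2 s /\ p \in slp_values s.

Definition logb (R : realType) (b x : R) : R := ln x / ln b.

Definition ln_k_term (R : realType) (n : nat) : R :=
  2 ^- n.+1 * ln (1 + (y n)%:R ^- 2).

Definition k (R : realType) : R := expR (limn (series (@ln_k_term R))).

(* Main.v *)
Require Import Defs.
From HB Require Import structures.
From mathcomp Require Import all_boot all_order all_algebra.
From mathcomp Require Import all_classical all_reals all_analysis.
From Stdlib Require Import Zify.
From mathcomp Require Import zify ring lra.

Set Implicit Arguments.
Unset Strict Implicit.
Unset Printing Implicit Defensive.

Import Order.TTheory GRing.Theory Num.Theory.
Import numFieldNormedType.Exports.
Local Open Scope classical_set_scope.
Local Open Scope ring_scope.

(** Let [L N] be the number of multiplications spent on [f(N, x)]. Two
    identities drive the construction.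
    - From [f(M N, x) = f(N, x) f(M, x^N)] and [x^N = (x - 1) f(N, x) + 1], one
      multiplication gives [x^N] and another joins the two factors, so that
      [L (M N) = L M + L N + 2]: the quantity [L + 2] is additive on products.
    - From [f(N^2 + 1, x) = 1 + x f(N, x) f(N, x^N)]: once [x f(N, x)] has been
      formed by one multiplication, [x^N = x f(N, x) - f(N, x) + 1] is free, so
      [L (N^2 + 1) = 2 L N + 2], that is [L + 2] doubles along the recurrence
      of [y].
    As [L 2 = 0], it follows that [L (y n) + 2 = 2^n] for [n >= 1], and
    [L (y n ^ m) + 2 = 2^n m] (lemmas [geom_cost_mul], [geom_cost_sqr_add1],
    [geom_cost_y_exp]).

    For the limit, [ln (y (n+1)) = 2 ln (y n) + ln (1 + (y n)^-2)] shows that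
    the partial sums of the series in the exponent of [k] are exactly
    [ln (y n) / 2^n] (lemma [series_ln_k_term]). They increase, whereas
    [ln (y n + 1) / 2^n] decreases because [y^2 + 2 <= (y + 1)^2]. So [ln k] is
    squeezed between [ln (y 4) / 16] and [ln (y 5 + 1) / 32], and comparing
    powers of these integers with powers of two locates [log_k 2] between
    [861/506] and [536/315], which lie in the required interval. *)

(** * Straight-line programs *)

(** A program for [p] that may be appended to any run which has produced the
    quantities [vals]; working relative to [vals] is what lets programs be
    chained, and run with another quantity in place of the variable. *)
Definition derivable (vals : seq {poly int}) (c : nat) (p : {poly int}) :=
  exists s : seq slp_step,
    [/\ slp_wf (size vals) s, slp_mults s = c & p \in foldl slp_exec vals s].

Lemma size_foldl_slp_exec s vals :
  size (foldl slp_exec vals s) = (size vals + size s)%N.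
Proof.
elim: s vals => [|[[u i] j] s IHs] vals /=; first by rewrite addn0.
by rewrite IHs size_rcons addSnnS.
Qed.

Lemma sub_foldl_slp_exec s vals : {subset vals <= foldl slp_exec vals s}.
Proof.
elim: s vals => [|[[u i] j] s IHs] vals p pv //=.
by apply: IHs; rewrite mem_rcons inE pv orbT.
Qed.

Lemma slp_wf_cat l s t : slp_wf l (s ++ t) = slp_wf l s && slp_wf (l + size s) t.
Proof.
elim: s l => [|[[u i] j] s IHs] l /=; first by rewrite addn0.
by rewrite IHs addSnnS !andbA.
Qed.

(** Sequencing: the continuation may use [p] together with all the earlier
    quantities. *)
Lemma derivable_bind vals c p d q : derivable vals c p ->
  (forall vals', {subset vals <= vals'} -> p \in vals' -> derivable vals' d q) ->
  derivable vals (c + d) q.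
Proof.
move=> [s [swf <- ps]] /(_ _ (@sub_foldl_slp_exec s vals) ps) [t [twf <- qt]].
exists (s ++ t); split.
- by rewrite slp_wf_cat swf -size_foldl_slp_exec.
- by rewrite /slp_mults count_cat.
- by rewrite foldl_cat.
Qed.

Lemma derivable_op o vals p q : p \in vals -> q \in vals ->
  derivable vals (if o is SlpMul then 1 else 0) (slp_apply o p q).
Proof.
move=> pv qv; exists [:: (o, index p vals, index q vals)]; split=> /=.
- by rewrite !index_mem pv qv.
- by case: o.
- by rewrite !nth_index // mem_rcons inE eqxx.
Qed.

(** * Programs for the geometric series *)

Definition gsum (N : nat) (z : {poly int}) : {poly int} :=
  \sum_(0 <= i < N) z ^+ i.

Definition geom_cost (c N : nat) := forall vals z,
  1 \in vals -> z \in vals -> derivable vals c (gsum N z).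

Lemma gsum0 z : gsum 0 z = 0.
Proof. exact: big_geq. Qed.

Lemma expr_gsum N z : z ^+ N = (z - 1) * gsum N z + 1.
Proof. by rewrite /gsum big_mkord -subrX1 subrK. Qed.

Lemma gsumD M N z : gsum (M + N) z = gsum M z + z ^+ M * gsum N z.
Proof.
have tail : \sum_(M <= i < M + N) z ^+ i = z ^+ M * gsum N z.
  rewrite -{1}[M]add0n big_addn addKn mulr_sumr.
  by apply: eq_bigr => i _; rewrite exprD mulrC.
by rewrite -tail /gsum (@big_cat_nat _ _ _ M) ?leq_addr.
Qed.

Lemma gsumM M N z : gsum (M * N) z = gsum N z * gsum M (z ^+ N).
Proof.
elim: M => [|M IHM]; first by rewrite mul0n !gsum0 mulr0.
rewrite -addn1 mulnDl mul1n !gsumD IHM mulrDr [gsum 1 _]big_nat1 expr0 mulr1.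
by rewrite -exprM [(N * M)%N]mulnC [z ^+ _ * _]mulrC.
Qed.

Lemma gsum_sqr_add1 N z :
  gsum (N ^ 2 + 1) z = 1 + z * gsum N z * gsum N (z ^+ N).
Proof.
by rewrite addnC gsumD [gsum 1 _]big_nat1 expr0 expr1 gsumM mulrA.
Qed.

Lemma geom_cost2 : geom_cost 0 2.
Proof.
move=> vals z v1 vz; rewrite /gsum !big_nat_recr //= big_geq // add0r.
exact: (derivable_op SlpAdd).
Qed.

(** The power [z ^+ N] costs one multiplication, by [expr_gsum]. *)
Lemma geom_cost_mul c d M N :
  geom_cost c M -> geom_cost d N -> geom_cost (c + d).+2 (M * N).
Proof.
move=> costM costN vals z v1 vz.
have -> : (c + d).+2 = (d + (0 + (1 + (0 + (c + 1)))))%N by lia.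
apply: (derivable_bind (costN _ _ v1 vz)) => v sv gv.
apply: (derivable_bind (derivable_op SlpSub (sv _ vz) (sv _ v1))) => w sw dw.
apply: (derivable_bind (derivable_op SlpMul dw (sw _ gv))) => u su mu.
have u1 : 1 \in u by apply/su/sw/sv.
apply: (derivable_bind (derivable_op SlpAdd mu u1)) => t st /=.
rewrite -expr_gsum => zt.
apply: (derivable_bind (costM _ _ (st _ u1) zt)) => r sr hr.
by rewrite gsumM; apply: (derivable_op SlpMul) => //; apply/sr/st/su/sw.
Qed.

(** Here [z * gsum N z] is a factor of the result, and it also yields [z ^+ N]
    without any further multiplication. *)
Lemma geom_cost_sqr_add1 c N :
  geom_cost c N -> geom_cost (c + c).+2 (N ^ 2 + 1).
Proof.
move=> cost vals z v1 vz.
have -> : (c + c).+2 = (c + (1 + (0 + (0 + (c + (1 + 0))))))%N by lia.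
apply: (derivable_bind (cost _ _ v1 vz)) => v sv gv.
apply: (derivable_bind (derivable_op SlpMul (sv _ vz) gv)) => w sw /= mw.
apply: (derivable_bind (derivable_op SlpSub mw (sw _ gv))) => u su /= du.
have u1 : 1 \in u by apply/su/sw/sv.
apply: (derivable_bind (derivable_op SlpAdd du u1)) => t st /=.
rewrite -[X in _ - X]mul1r -mulrBl -expr_gsum => zt.
apply: (derivable_bind (cost _ _ (st _ u1) zt)) => r sr hr.
have mr := sr _ (st _ (su _ mw)).
apply: (derivable_bind (derivable_op SlpMul mr hr)) => q sq /= mq.
by rewrite gsum_sqr_add1; apply: (derivable_op SlpAdd) => //; apply/sq/sr/st.
Qed.

Lemma geom_cost_y n : geom_cost (2 ^ n.+1 - 2) (y n.+1).
Proof.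
elim: n => [|n IHn]; first exact: geom_cost2.
have -> : (2 ^ n.+2 - 2 = ((2 ^ n.+1 - 2) + (2 ^ n.+1 - 2)).+2)%N.
  by have := expn_gt0 2 n; rewrite !expnS; lia.
exact: (geom_cost_sqr_add1 IHn).
Qed.

Lemma geom_cost_y_exp n m : geom_cost (2 ^ n.+1 * m.+1 - 2) (y n.+1 ^ m.+1).
Proof.
elim: m => [|m IHm]; first by rewrite muln1 expn1; exact: geom_cost_y.
have -> : (2 ^ n.+1 * m.+2 - 2
    = ((2 ^ n.+1 - 2) + (2 ^ n.+1 * m.+1 - 2)).+2)%N.
  have : (2 <= 2 ^ n.+1)%N by rewrite expnS leq_pmulr // expn_gt0.
  by nia.
by rewrite [(y _ ^ _)%N]expnS; apply: geom_cost_mul => //; apply: geom_cost_y.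
Qed.

Lemma computes_geom c N : geom_cost c N ->
  exists s, computes s (geom N) /\ slp_mults s = c.
Proof.
move=> /(_ [:: 1; 'X]); case/(_ 'X); rewrite ?inE ?eqxx ?orbT // => s [wf <- ps].
by exists s.
Qed.

(** * The limit of the coefficients *)

Lemma y_gt0 n : (0 < y n)%N.
Proof. by case: n => //= n; rewrite addn1. Qed.

Lemma y_gt1 n : (1 < y n.+1)%N.
Proof. by rewrite /= addn1 ltnS expn_gt0 y_gt0. Qed.

(** Taking logarithms and dividing by [2 ^ (i + j)], this says that
    [ln (y n + 1) / 2 ^ n] does not increase; it holds since
    [(a ^ 2 + 1) + 1 <= (a + 1) ^ 2] for [a >= 1]. *)
Lemma yS_le i j : ((y (i + j)).+1 <= (y i).+1 ^ (2 ^ j))%N.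
Proof.
elim: j => [|j IHj]; first by rewrite addn0 expn1.
rewrite addnS expnSr expnM /=.
apply: (@leq_trans ((y (i + j)).+1 ^ 2)); last by rewrite leq_exp2r.
by have := y_gt0 (i + j); rewrite !expnS; nia.
Qed.

Section Limit.
Variable R : realType.
Local Notation term := (@ln_k_term R).

Lemma yR_gt0 n : 0 < (y n)%:R :> R. Proof. by rewrite ltr0n y_gt0. Qed.

(** As [y n.+1 = y n ^ 2 * (1 + (y n) ^- 2)], dividing the logarithm by
    [2 ^ n.+1] makes the series telescope, from [ln (y 0) = 0]. *)
Lemma series_ln_k_term n : series term n = ln (y n)%:R / 2 ^+ n.
Proof.
elim: n => [|n IHn]; first by rewrite /series /= big_geq // ln1 mul0r.
have y0 := yR_gt0 n.
have -> : (y n.+1)%:R = (y n)%:R ^+ 2 * (1 + (y n)%:R ^- 2) :> R.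
  by rewrite mulrDr mulr1 mulfV ?expf_neq0 ?gt_eqF //= natrD natrX.
rewrite seriesSr IHn /ln_k_term lnM ?posrE ?addr_gt0 ?invr_gt0 ?exprn_gt0 //.
by rewrite lnXn // exprS -mulr_natr; field; rewrite expf_neq0 ?pnatr_eq0.
Qed.

Lemma series_ln_k_term_homo : {homo series term : i j / (i <= j)%N >-> i <= j}.
Proof.
apply/nondecreasing_seqP => n; rewrite seriesSr lerDl mulr_ge0 //.
by rewrite ln_ge0 // lerDl invr_ge0 exprn_ge0.
Qed.

(** All indices [i] and [n] are compared, not only [i = n]: the increasing and
    decreasing sequences are adjacent. One passes through the index [i + n]. *)
Lemma series_ln_k_term_le i n : series term n <= ln (y i).+1%:R / 2 ^+ i.
Proof.
have : series term n <= series term (i + n).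
  by apply: series_ln_k_term_homo; exact: leq_addl.
move/le_trans; apply.
rewrite series_ln_k_term ler_pdivrMr ?exprn_gt0 // exprD mulrA.
rewrite divfK ?expf_neq0 ?pnatr_eq0 // -natrX mulr_natr -lnXn ?ltr0n //.
rewrite -natrX ler_ln ?posrE ?yR_gt0 ?ltr0n ?expn_gt0 // ler_nat.
exact: ltnW (yS_le i n).
Qed.

Lemma cvg_series_ln_k_term : cvgn (series term).
Proof.
apply: nondecreasing_is_cvgn; first exact: series_ln_k_term_homo.
by exists (ln (y 0).+1%:R / 2 ^+ 0) => _ [n _ <-]; apply: series_ln_k_term_le.
Qed.

Lemma ln_k : ln (k R) = limn (series term).
Proof. exact: expRK. Qed.

Lemma ln_k_ge n : ln (y n)%:R / 2 ^+ n <= ln (k R).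
Proof.
rewrite ln_k -series_ln_k_term.
exact: nondecreasing_cvgn_le series_ln_k_term_homo cvg_series_ln_k_term n.
Qed.

Lemma ln_k_le n : ln (k R) <= ln (y n).+1%:R / 2 ^+ n.
Proof.
rewrite ln_k; apply: limr_le; first exact: cvg_series_ln_k_term.
by apply: nearW => i; apply: series_ln_k_term_le.
Qed.

Lemma ln2_gt0 : 0 < ln 2 :> R. Proof. by rewrite ln_gt0 // ltr1n. Qed.

Lemma ln_k_gt0 : 0 < ln (k R).
Proof.
by apply: lt_le_trans (ln_k_ge 1); rewrite divr_gt0 ?ln2_gt0.
Qed.

Lemma cvg_coef :
  (fun n : nat => 2 ^+ n / logb 2 (y n)%:R : R) @ \oo --> logb (k R) 2.
Proof.
have -> : (fun n : nat => 2 ^+ n / logb 2 (y n)%:R : R)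
    = (fun n => ln 2 * (series term n)^-1).
  by apply/funext => n; rewrite series_ln_k_term /logb !invf_div mulrCA mulrA.
apply: cvgMl_tmp; apply: cvgV; first by rewrite gt_eqF ?ln_k_gt0.
rewrite ln_k; exact: cvg_series_ln_k_term.
Qed.

(** * The numerical value *)

Lemma y4E : y 4 = 677%N. Proof. by []. Qed.

Lemma leq_expn_pow2_mul a b m n e f :
  (a ^ m <= b * 2 ^ e)%N -> (b ^ n <= 2 ^ f)%N ->
  (a ^ (m * n) <= 2 ^ (f + e * n))%N.
Proof.
move=> le_am le_bn; rewrite expnD !expnM.
apply: (@leq_trans ((b * 2 ^ e) ^ n)).
  by case: n {le_bn} => // n; rewrite leq_exp2r.
by rewrite expnMn leq_mul2r le_bn orbT.
Qed.

(** As [21 * 41 = 861] and [489 + 383 * 41 = 32 * 506], this says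
    [861/506 <= ln 2 / (ln (y 5 + 1) / 32)]; the fraction sits just above
    [1.70158]. Rounding the 21st power up to [3893 * 2 ^ 383] loses little
    enough for the 41st power of the result, and keeps the integers to evaluate
    below 500 bits. *)
Lemma pow_y5S_le : ((y 5).+1 ^ (21 * 41) <= 2 ^ (489 + 383 * 41))%N.
Proof.
have -> : (y 5).+1 = (677 ^ 2 + 2)%N.
  by rewrite -y4E addnS.
apply: (@leq_expn_pow2_mul _ 3893); first by zify; vm_compute.
by zify; vm_compute.
Qed.

(** This says [ln 2 / (ln (y 4) / 16) <= 536/315], as [16 * 67 / 630 = 536/315];
    the fraction sits just below [1.70159]. *)
Lemma pow_y4_ge : (2 ^ 630 <= y 4 ^ 67)%N.
Proof. by rewrite y4E; zify; vm_compute. Qed.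

Lemma ln_expn (a n : nat) : (0 < a)%N -> ln (a ^ n)%:R = n%:R * ln a%:R :> R.
Proof. by move=> a0; rewrite natrX lnXn ?ltr0n // mulr_natl. Qed.

Lemma ler_ln_expn (a b m n : nat) : (0 < a)%N -> (0 < b)%N ->
  (a ^ m <= b ^ n)%N -> m%:R * ln a%:R <= n%:R * ln b%:R :> R.
Proof.
move=> a0 b0 le_ab; rewrite -!ln_expn //.
by rewrite ler_ln ?posrE ?ltr0n ?expn_gt0 ?a0 ?b0 // ler_nat.
Qed.

Lemma logb_k_bounds :
  1 + 701 / 10 ^+ 3 + 58 / 10 ^+ 5 <= logb (k R) 2
    < 1 + 701 / 10 ^+ 3 + 59 / 10 ^+ 5.
Proof.
have k0 := ln_k_gt0; have l2 := ln2_gt0.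
have lo := ln_k_ge 4; have hi := ln_k_le 5.
have pow_lo := @ler_ln_expn 2 (y 4) _ _ isT (y_gt0 4) pow_y4_ge.
have pow_hi := @ler_ln_expn (y 5).+1 2 _ _ (ltn0Sn _) isT pow_y5S_le.
move: (ln (y 4)%:R) (ln (y 5).+1%:R) lo hi pow_lo pow_hi => A B lo hi pow_lo pow_hi.
rewrite /logb ler_pdivlMr // ltr_pdivrMr //.
rewrite natrD !natrM in pow_hi.
by apply/andP; split; lra.
Qed.

End Limit.

Theorem mainTheorem3 (R : realType) :
  [/\ forall n m N : nat, (1 <= n)%N -> (1 <= m)%N -> N = (y n ^ m)%N ->
        (exists s : seq slp_step, computes s (geom N) /\
           (slp_mults s)%:R = 2 ^+ n * logb (y n)%:R N%:R - 2 :> R) /\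
        2 ^+ n * logb (y n)%:R N%:R - 2
          = 2 ^+ n / logb 2 (y n)%:R * logb 2 N%:R - 2 :> R,
      cvgn (series (@ln_k_term R)),
      (fun n : nat => 2 ^+ n / logb 2 (y n)%:R : R) @ \oo --> logb (k R) 2
    & 1 + 701 / 10 ^+ 3 + 58 / 10 ^+ 5 <= logb (k R) 2
        < 1 + 701 / 10 ^+ 3 + 59 / 10 ^+ 5].
Proof.
split; [|exact: cvg_series_ln_k_term|exact: cvg_coef|exact: logb_k_bounds].
move=> [//|n] [//|m] N _ _ ->.
have lny : ln (y n.+1)%:R != 0 :> R by rewrite gt_eqF ?ln_gt0 ?ltr1n ?y_gt1.
have ln2 : ln 2 != 0 :> R by rewrite gt_eqF ?ln2_gt0.
rewrite /logb ln_expn ?y_gt0 //; split; last by field; apply/andP.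
have [s [s_geom s_mults]] := computes_geom (geom_cost_y_exp n m).
exists s; split=> //; rewrite s_mults natrB; last first.
  by rewrite expnS -mulnA leq_pmulr // muln_gt0 expn_gt0.
by rewrite natrM natrX mulfK.
Qed.
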